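(* Let $T>0$. Let $w\in H^1((0,T);\mathcal V)$ be continuous on $[0,T]$ with values in $\mathcal V_{(-\infty,1]}$, and let $u\in H^1((0,T);\mathcal V)$ be continuous on $[0,T]$ with values in $\mathcal V_{[0,1]}$ and satisfy, for a.e. $t\in(0,T)$, $$\forall\eta\in\mathcal V_{[0,1]},\quad\left\langle\frac{du}{dt}-\frac1\varepsilon u(t)+\frac1{2\varepsilon}\mathbf 1,\ \eta-u(t)\right\rangle_{\mathcal V}+\left\langle\nabla u(t),\nabla\eta-\nabla u(t)\right\rangle_{\mathcal E}\ge0 .$$ Suppose that $w_i(0)\le u_i(0)$ for all $i\in V$, and that there exists $f:(0,T)\to\mathcal V$ such that for all $T^*\in[0,T]$ $$\int_0^{T^*}\langle f(t),(w-u)_+(t)\rangle_{\mathcal V}\,dt\le\int_0^{T^*}\langle w(t),(w-u)_+(t)\rangle_{\mathcal V}\,dt$$ and, for all $\eta:(0,T)\to\mathcal V_{[0,\infty)}$ (for which the integral is defined), $$\int_0^T\left\langle\frac{dw}{dt}+\frac1{2\varepsilon}\mathbf 1,\eta\right\rangle_{\mathcal V}+\langle\nabla w,\nabla\eta\rangle_{\mathcal E}-\frac1\varepsilon\langle f,\eta\rangle_{\mathcal V}\,dt\le0 .$$ Then $w_i(t)\le u_i(t)$ for all $i\in V$ and all $t\in[0,T]$.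
   Context: Let $G=(V,E)$ be a finite, undirected, simple, connected graph with symmetric weights $\omega_{ij}=\omega_{ji}$, $\omega_{ij}>0$ for $ij\in E$ and $\omega_{ij}=0$ for $ij\notin E$. Let $d_i=\sum_{j}\omega_{ij}>0$ be the degree of $i\in V$. Fix $r\in[0,1]$ and $\varepsilon>0$. Let $\mathcal V=\{u:V\to\mathbb R\}$ and, for $X\subseteq\mathbb R$, $\mathcal V_X=\{u:V\to X\}$; $\mathcal V$ carries the inner product $\langle u,v\rangle_{\mathcal V}=\sum_{i\in V}u_iv_id_i^r$. Let $\mathcal E=\{\varphi:E\to\mathbb R\mid\varphi_{ij}=-\varphi_{ji}\}$ with $\langle\varphi,\phi\rangle_{\mathcal E}=\frac12\sum_{i,j\in V}\varphi_{ij}\phi_{ij}\omega_{ij}$. $\mathbf 1\in\mathcal V$ is the constant function $1$. The graph gradient is $(\nabla u)_{ij}=u_j-u_i$ for $ij\in E$ (and $0$ otherwise). For an open interval $I$, $H^1(I;\mathcal V)$ is the set of $u\in L^2(I;\mathcal V)$ with generalised (weak) time derivative $du/dt\in L^2(I;\mathcal V)$. For $z:[0,T]\to\mathcal V$, $z_+$ is the positive part, $(z_+)_i(t)=\max\{z_i(t),0\}$. The function $f$ is understood to be such that the integrals $\int_0^{T^*}\langle f,(w-u)_+\rangle_{\mathcal V}\,dt$ exist (i.e. $\langle f,(w-u)_+\rangle_{\mathcal V}$ is integrable); the second integral condition is required for those $\eta$ whose integrand is integrable on $(0,T)$. *)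

(* Defs.v *)
From HB Require Import structures.
From mathcomp Require Import all_boot all_order all_algebra.
From mathcomp Require Import all_classical all_reals all_analysis.

Set Implicit Arguments.
Unset Strict Implicit.
Unset Printing Implicit Defensive.

Import Order.TTheory GRing.Theory Num.Theory.
Import numFieldNormedType.Exports.

Local Open Scope classical_set_scope.
Local Open Scope ring_scope.

Record wgraph (R : realType) (V : finType) := WGraph {
  adj : rel V;
  weight : V -> V -> R;
  adj_sym : symmetric adj;
  adj_irr : irreflexive adj;
  adj_connected : forall i j, connect adj i j;
  weight_sym : forall i j, weight i j = weight j i;
  weight_gt0 : forall i j, adj i j -> 0 < weight i j;
  weight_eq0 : forall i j, ~~ adj i j -> weight i j = 0;
  degree_gt0 : forall i, 0 < \sum_j weight i j }.

Section Definitions.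
Context {R : realType} {V : finType}.
Implicit Types (G : wgraph R V) (r : R) (X I : set R).

Local Notation mu := (@lebesgue_measure R).

Definition degree G (i : V) : R := \sum_j weight G i j.

Definition VX X : set (V -> R) := [set u | forall i, X (u i)].

Definition ipV G r (u v : V -> R) : R :=
  \sum_i u i * v i * degree G i `^ r.

(* Edge functions are extended by 0 to all pairs of vertices. *)
Definition ipE G (phi psi : V -> V -> R) : R :=
  2^-1 * \sum_i \sum_j phi i j * psi i j * weight G i j.

Definition grad G (u : V -> R) : V -> V -> R :=
  fun i j => if adj G i j then u j - u i else 0.

Definition L2 G r I (u : R -> V -> R) : Prop :=
  (forall i, measurable_fun I (u ^~ i)) /\
  (\int[mu]_(t in I) (ipV G r (u t) (u t))%:E < +oo)%E.

(* C_c^oo(I), seen as functions on R vanishing outside I. *)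
Definition test_function I (phi : R -> R) : Prop :=
  [/\ forall n t, derivable (derive1n n phi) t 1,
      compact (closure [set t | phi t != 0]) &
      closure [set t | phi t != 0] `<=` I].

(* Since V is finite, the V-valued identity is read coordinate by coordinate. *)
Definition weak_derivative I (u du : R -> V -> R) : Prop :=
  forall i phi, test_function I phi ->
    \int[mu]_(t in I) (u t i * derive1 phi t) =
      - \int[mu]_(t in I) (du t i * phi t).

(* u is in H^1(I; V) and du represents its weak derivative, which is unique
   up to a null set. *)
Definition H1 G r I (u du : R -> V -> R) : Prop :=
  [/\ L2 G r I u, L2 G r I du & weak_derivative I u du].

End Definitions.

(* Main.v *)
Require Import Defs.
From HB Require Import structures.
From mathcomp Require Import all_boot all_order all_algebra.
From mathcomp Require Import all_classical all_reals all_analysis.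
From mathcomp Require Import measurable_realfun ring lra.

Set Implicit Arguments.
Unset Strict Implicit.
Unset Printing Implicit Defensive.

Import Order.TTheory GRing.Theory Num.Theory.
Import numFieldNormedType.Exports.

Local Open Scope classical_set_scope.
Local Open Scope ring_scope.

(** The difference [v = w - u] satisfies an energy inequality for its positive
part [z = v_+].  Testing the inequality for [w] with [eta = z] on [(0, x)] and
[eta = 0] afterwards, and the variational inequality for [u] with
[eta = u + z = max u w], which lies in [[0, 1]] because [w <= 1], and
subtracting, gives
  [int_0^x <v', z> + <grad v, grad z> - eps^-1 <v, z> <= 0];
the hypothesis on [f] replaces [<f, z>] by [<w, z>] here.  The gradient term is
nonnegative because [s |-> s_+] is nondecreasing, and [<v, z> = |z|^2]
(comparison_pointwise).  By the chain rule for [s_+^2 / 2]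
(positive_part_energy_ipV) and [z(0) = 0], it follows that
  [|z(x)|^2 <= 2 int_0^x <v', z> <= 2 eps^-1 int_0^x |z|^2],
so [z = 0] by Gronwall's lemma (gronwall_zero).

The chain rule needs that a continuous function with an integrable weak
derivative is the integral of that derivative (weak_derivative_FTC).  This is
obtained by testing with smooth approximations of the indicator of an interval:
differences of translated and rescaled copies of a smooth step built from
[exp (-1/x)].  The derivatives of these copies form an approximate identity
(approximate_identity), which recovers the values of [v], while dominated
convergence (cut_off_limit) handles the other side.  Because [s_+^2 / 2] is
convex, the chain rule is needed only as an inequality, and it follows from a
first-order expansion over a fine mesh. *)

(** * Functions with finitely many derivatives *)

(** Recursion on the derivative of [f], rather than on the iterated derivative,
makes the closure properties below plain inductions on [n]. *)
Fixpoint differentiable_times {R : realType} (n : nat) (f : R -> R) : Prop :=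
  if n is m.+1 then
    (forall x : R, derivable f x (1 : R)) /\ differentiable_times m (derive1 f)
  else True.

Section Smooth.
Context {R : realType}.
Implicit Types f g df : R -> R.

Lemma differentiable_timesP f :
  (forall n, differentiable_times n f) ->
  forall n t, derivable (derive1n n f) t 1.
Proof.
move=> + n; elim: n f => [|n IH] f Df t.
  by have [] := Df 1%N; rewrite derive1n0.
by rewrite derive1Sn; apply: IH => m; have [] := Df m.+1.
Qed.

Lemma differentiable_timesS n f df :
  (forall x : R, is_derive x (1 : R) f (df x)) -> differentiable_times n df ->
  differentiable_times n.+1 f.
Proof.
move=> fdf ndf; split; first by move=> x; have [] := fdf x.
suff -> : derive1 f = df by [].
by apply/funext => x; rewrite derive1E; apply: derive_val.
Qed.

Lemma differentiable_timesW n f :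
  differentiable_times n.+1 f -> differentiable_times n f.
Proof.
by elim: n f => [//|n IH] f [Df Dn]; split=> //; exact: IH.
Qed.

Lemma is_derive_derive1 f x : derivable f (x : R) (1 : R) ->
  is_derive x (1 : R) f (derive1 f x).
Proof. by move=> fx; rewrite derive1E; exact/derivableP. Qed.

Lemma is_derive_inv f (x d : R) : f x != 0 -> is_derive x (1 : R) f d ->
  is_derive x (1 : R) (fun y => (f y)^-1) (- (f x) ^- 2 * d).
Proof.
move=> fx0 [fx <-]; split; first exact: derivableV.
by rewrite deriveV.
Qed.

Lemma differentiable_times_cst n (k : R) : differentiable_times n (cst k).
Proof.
elim: n k => [//|n IH] k.
by apply: (@differentiable_timesS _ _ (cst 0)) => // x; exact: is_derive_cst.
Qed.

Lemma differentiable_timesD n f g : differentiable_times n f ->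
  differentiable_times n g -> differentiable_times n (f \+ g).
Proof.
elim: n f g => [//|n IH] f g [Df nf] [Dg ng].
apply: (@differentiable_timesS _ _ (derive1 f \+ derive1 g)); last exact: IH.
by move=> x; apply: is_deriveD; exact: is_derive_derive1.
Qed.

Lemma differentiable_timesM n f g : differentiable_times n f ->
  differentiable_times n g -> differentiable_times n (f \* g).
Proof.
elim: n f g => [//|n IH] f g nf ng.
have [Df nf'] := nf; have [Dg ng'] := ng.
apply: (@differentiable_timesS _ _ ((f \* derive1 g) \+ (g \* derive1 f))).
  move=> x.
  by apply: is_deriveM; exact: is_derive_derive1.
by apply: differentiable_timesD; apply: IH => //; exact: differentiable_timesW.
Qed.

Lemma differentiable_timesV n f : (forall x, f x != 0) ->
  differentiable_times n f -> differentiable_times n (fun x => (f x)^-1).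
Proof.
move=> f0; elim: n => [//|n IH] nf; have [Df nf'] := nf.
have nV := IH (differentiable_timesW nf).
have dV x := is_derive_inv (f0 x) (is_derive_derive1 (Df x)).
apply: (differentiable_timesS dV).
rewrite (_ : (fun x => _) = cst (-1) \*
    (derive1 f \* ((fun x => (f x)^-1) \* (fun x => (f x)^-1)))).
  by repeat apply: differentiable_timesM => //; exact: differentiable_times_cst.
by apply/funext => x; rewrite /= expr2 invfM mulN1r mulNr mulrC.
Qed.

Lemma differentiable_times_affine n f (a b : R) : differentiable_times n f ->
  differentiable_times n (fun x => f (a * x + b)).
Proof.
elim: n f => [//|n IH] f [Df nf].
apply: (@differentiable_timesS _ _ ((fun x => derive1 f (a * x + b)) \* cst a)).
  move=> x.
  have ? : is_derive x (1 : R) (fun x => a * x + b) a.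
    have := is_deriveD (is_deriveZ a (is_derive_id x (1 : R)))
      (is_derive_cst b x (1 : R)).
    by rewrite addr0 /GRing.scale/= mulr1.
  have ? := is_derive_derive1 (Df (a * x + b)).
  exact: (@is_derive1_comp _ f (fun x => a * x + b)).
by apply: differentiable_timesM; [exact: IH|exact: differentiable_times_cst].
Qed.

(** * A smooth step *)

(** The function [x |-> x^-n exp (-1/x)], extended by [0] to [x <= 0].
All powers are considered at once because the derivative of such a function is
a linear combination of functions of the same form. *)
Definition flat (n : nat) (x : R) : R :=
  if 0 < x then x^-1 ^+ n * expR (- x^-1) else 0.

Lemma flat_ge0 n x : 0 <= flat n x.
Proof.
rewrite /flat; case: ifPn => // x0.
by rewrite mulr_ge0 ?expR_ge0 ?exprn_ge0 ?invr_ge0 ?ltW.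
Qed.

Lemma flat_gt0 n x : 0 < x -> 0 < flat n x.
Proof.
by move=> x0; rewrite /flat x0 mulr_gt0 ?expR_gt0 ?exprn_gt0 ?invr_gt0.
Qed.

Lemma flat_eq0 n x : x <= 0 -> flat n x = 0.
Proof. by move=> x0; rewrite /flat ltNge x0. Qed.

Lemma flatS n x : flat n.+1 x = x^-1 * flat n x.
Proof. by rewrite /flat; case: ifPn => _; rewrite ?mulr0// exprS mulrA. Qed.

(** With [y = 1/x] this is [y^n <= n! exp y], a term of the exponential series. *)
Lemma flat_bounded n : exists C : R, forall x, flat n x <= C.
Proof.
exists (n`!%:R); move=> x; rewrite /flat; case: ifPn => // x0.
have y0 : 0 < x^-1 by rewrite invr_gt0.
rewrite expRN ler_pdivrMr ?expR_gt0// -ler_pdivrMl ?ltr0n ?fact_gt0//.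
rewrite mulrC; case: n => [|n].
  by rewrite expr0 fact0 divr1; apply/ltW; rewrite expR_gt1.
by apply: le_trans (expR_ge1Dxn n (ltW y0)); rewrite lerDr.
Qed.

(** At [0], the difference quotient at [h] is [flat n.+1 h], which is [h] times
the bounded function [flat n.+2], hence tends to [0]. *)
Lemma is_derive_flat n (x : R) :
  is_derive x (1 : R) (flat n) (flat n.+2 x - n%:R * flat n.+1 x).
Proof.
have [x0|x0|->] := ltgtP x 0.
- rewrite !flat_eq0 ?ltW// mulr0 subr0.
  apply: (@near_eq_is_derive _ _ _ (cst 0)).
    near=> y; rewrite /= flat_eq0//.
    near: y; exact: lt_le_nbhsl.
- have xn0 : x != 0 by rewrite gt_eqF.
  apply: (@near_eq_is_derive _ _ _ (fun y : R => y^-1 ^+ n * expR (- y^-1))).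
  + near=> y; rewrite /flat ifT//.
    by near: y; exact: lt_nbhsr.
  + have Hv : is_derive x (1 : R) (fun x => x^-1) (- x ^- 2).
      have := is_derive_inv xn0 (is_derive_id x (1 : R)).
      by rewrite mulr1.
    have He : is_derive x 1 (fun y : R => expR (- y^-1)) (expR (- x^-1) * x ^- 2).
      apply: is_derive_eq.
      by rewrite opprK.
    have Hx : is_derive x 1 (fun y : R => y^-1 ^+ n) (n%:R * x^-1 ^+ n.-1 * - x ^-2).
      by have := is_deriveX n Hv; rewrite exprfctE.
    apply: is_derive_eq (is_deriveM Hx He) _.
    rewrite /GRing.scale /= /flat x0; case: n Hx => [|n] _.
      by rewrite !mul0r mulr0 addr0 subr0 expr0 mul1r exprVn mulrC.
    by rewrite -pred_Sn -exprVn !exprS expr0; move: (x^-1) (expR _) => y e; ring.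
- rewrite !flat_eq0// mulr0 subr0.
  have [C flatC] := flat_bounded n.+2.
  have C0 : 0 <= C := le_trans (flat_ge0 _ _) (flatC 0).
  have C1 : 0 < C + 1 by rewrite ltr_wpDl.
  suff F : (fun h : R => h^-1 *: ((flat n \o shift 0) (h *: 1) - flat n 0))
      @ 0^' --> (0 : R).
    by split; [apply/cvg_ex; exists 0|exact: cvg_lim F].
  apply/cvgrPdist_le => e e0; near=> h.
  rewrite sub0r normrN /= [flat n 0]flat_eq0// subr0 addr0 /GRing.scale /= mulr1.
  rewrite -flatS ger0_norm ?flat_ge0//.
  have [h0|h0] := leP h 0; first by rewrite flat_eq0// ltW.
  have -> : flat n.+1 h = h * flat n.+2 h.
    by rewrite [in RHS]flatS mulrA divff ?mul1r ?gt_eqF.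
  apply: (@le_trans _ _ (e / (C + 1) * (C + 1))); last by rewrite divfK ?gt_eqF.
  apply: ler_pM; [exact: ltW|exact: flat_ge0| |].
    apply: le_trans (ler_norm _) _.
    near: h; apply: dnbhs0_le; exact: divr_gt0.
  by rewrite (le_trans (flatC _))// lerDl.
Unshelve. all: by end_near.
Qed.

Lemma differentiable_times_flat m n : differentiable_times m (flat n).
Proof.
elim: m n => [//|m IH] n.
apply: (differentiable_timesS (is_derive_flat n)).
rewrite (_ : (fun x => _) = flat n.+2 \+ (cst (- n%:R) \* flat n.+1)); last first.
  by apply/funext => x /=; rewrite mulNr.
apply: differentiable_timesD => //.
by apply: differentiable_timesM => //; exact: differentiable_times_cst.
Qed.

Definition smooth_step (x : R) : R :=
  flat 0 x / (flat 0 x + flat 0 (1 - x)).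

Lemma smooth_step_den_gt0 x : 0 < flat 0 x + flat 0 (1 - x).
Proof.
have [x0|x0] := leP x 0.
  by rewrite flat_eq0// add0r flat_gt0// subr_gt0 (le_lt_trans x0).
by rewrite ltr_wpDr ?flat_ge0 ?flat_gt0.
Qed.

Lemma smooth_step_eq0 x : x <= 0 -> smooth_step x = 0.
Proof. by move=> x0; rewrite /smooth_step flat_eq0 ?mul0r. Qed.

Lemma smooth_step_eq1 x : 1 <= x -> smooth_step x = 1.
Proof.
move=> x1; rewrite /smooth_step [X in _ + X]flat_eq0 ?subr_le0// addr0 divff//.
by rewrite gt_eqF// flat_gt0// (lt_le_trans _ x1).
Qed.

Lemma smooth_step_ge0 x : 0 <= smooth_step x.
Proof. by rewrite divr_ge0 ?flat_ge0 ?ltW ?smooth_step_den_gt0. Qed.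

Lemma smooth_step_le1 x : smooth_step x <= 1.
Proof.
by rewrite ler_pdivrMr ?smooth_step_den_gt0// mul1r lerDl flat_ge0.
Qed.

Lemma differentiable_times_smooth_step n : differentiable_times n smooth_step.
Proof.
apply: differentiable_timesM; first exact: differentiable_times_flat.
apply: differentiable_timesV => [x|]; first by rewrite gt_eqF ?smooth_step_den_gt0.
apply: differentiable_timesD; first exact: differentiable_times_flat.
rewrite (_ : (fun x => _) = fun x => flat 0 (-1 * x + 1)); last first.
  by apply/funext => x; rewrite mulN1r addrC.
exact/differentiable_times_affine/differentiable_times_flat.
Qed.

Lemma derivable_smooth_step x : derivable smooth_step x 1.
Proof. by have [] := differentiable_times_smooth_step 1. Qed.

(** With [f = flat 0] and [g x = f (1 - x)], the quotient rule gives
[(f / (f + g))' = (f' g - f g') / (f + g)^2], where [f' >= 0 >= g']. *)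
Lemma smooth_step_derive_ge0 x : 0 <= derive1 smooth_step x.
Proof.
have fx := is_derive_flat 0 x; have fy := is_derive_flat 0 (1 - x).
have f1 : is_derive x (1 : R) (fun y : R => 1 - y) (- 1).
  have := is_deriveB (is_derive_cst (1 : R) x (1 : R)) (is_derive_id x (1 : R)).
  by rewrite sub0r.
have fc : is_derive x (1 : R) (fun y => flat 0 (1 - y))
    ((flat 2 (1 - x) - 0%:R * flat 1 (1 - x)) * -1).
  exact: (@is_derive1_comp _ (flat 0) (fun y => 1 - y) _ _ _ fy f1).
have g0 : flat 0 x + flat 0 (1 - x) != 0 by rewrite gt_eqF// smooth_step_den_gt0.
have gV := @is_derive_inv (fun y => flat 0 y + flat 0 (1 - y)) x _ g0
  (is_deriveD fx fc).
have [_ SD] := is_deriveM fx gV.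
rewrite derive1E.
have -> : 'D_1 smooth_step x =
  'D_1 (flat 0 * (fun y : R => (flat 0 y + flat 0 (1 - y))^-1)) x by [].
rewrite SD /GRing.scale /= !mul0r !subr0.
move: g0 (flat_ge0 0 x) (flat_ge0 0 (1 - x)) (flat_ge0 2 x) (flat_ge0 2 (1 - x)).
move: (flat 0 x) (flat 0 (1 - x)) (flat 2 x) (flat 2 (1 - x)) => a b c d ab a0 b0 c0 d0.
rewrite (_ : _ + _ = (a * d + b * c) / (a + b) ^+ 2); last by field.
by rewrite divr_ge0 ?sqr_ge0// addr_ge0 ?mulr_ge0.
Qed.

Lemma smooth_step_derive_eq0 x : x < 0 \/ 1 < x -> derive1 smooth_step x = 0.
Proof.
move=> [x0|x1]; rewrite derive1E.
- rewrite (@near_eq_derive _ _ _ _ (cst (0 : R))) ?derive_cst//.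
  by near=> y; rewrite smooth_step_eq0//; near: y; exact: lt_le_nbhsl.
- rewrite (@near_eq_derive _ _ _ _ (cst (1 : R))) ?derive_cst//.
  by near=> y; rewrite smooth_step_eq1//; near: y; exact: lt_le_nbhsr.
Unshelve. all: by end_near.
Qed.
End Smooth.

(** * Integrals of real-valued functions *)

Section RealIntegrable.
Context d (T : measurableType d) (R : realType).
Variable mu : {measure set T -> \bar R}.
Implicit Types (D : set T) (f g h : T -> R).

Lemma integrable_scale D k f : measurable D -> mu.-integrable D (EFin \o f) ->
  mu.-integrable D (EFin \o (fun x => k * f x)).
Proof. by move=> mD fi; have := integrableZl mD k fi. Qed.

Lemma integrable_add D f g : measurable D -> mu.-integrable D (EFin \o f) ->
  mu.-integrable D (EFin \o g) -> mu.-integrable D (EFin \o (fun x => f x + g x)).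
Proof. by move=> mD fi gi; have := integrableD mD fi gi. Qed.

Lemma integrable_sub D f g : measurable D -> mu.-integrable D (EFin \o f) ->
  mu.-integrable D (EFin \o g) -> mu.-integrable D (EFin \o (fun x => f x - g x)).
Proof. by move=> mD fi gi; have := integrableB mD fi gi. Qed.

Lemma integrable_sumR D (I : Type) (s : seq I) (F : I -> T -> R) :
  measurable D -> (forall i, mu.-integrable D (EFin \o F i)) ->
  mu.-integrable D (EFin \o (fun x => \sum_(i <- s) F i x)).
Proof.
move=> mD Fi; have := integrable_sum mD s (fun i (_ : xpredT i) => Fi i).
by apply: eq_integrable => // x _; rewrite /= sumEFin.
Qed.

Lemma Rintegral_sum D (I : Type) (s : seq I) (F : I -> T -> R) :
  measurable D -> (forall i, mu.-integrable D (EFin \o F i)) ->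
  \int[mu]_(x in D) (\sum_(i <- s) F i x) = \sum_(i <- s) \int[mu]_(x in D) F i x.
Proof.
move=> mD Fi; elim: s => [|i s IH].
  rewrite big_nil; under eq_Rintegral do rewrite big_nil.
  by rewrite Rintegral_cst// mul0r.
under eq_Rintegral do rewrite big_cons.
by rewrite big_cons RintegralD ?IH//; exact: integrable_sumR.
Qed.

Lemma integrable_mulr D f h (M : R) : measurable D ->
  mu.-integrable D (EFin \o f) -> measurable_fun D h ->
  (forall x, D x -> `|h x| <= M) ->
  mu.-integrable D (EFin \o (fun x => f x * h x)).
Proof.
move=> mD fi mh hM.
have mf : measurable_fun D f by apply/measurable_EFinP; exact: measurable_int fi.
apply: (le_integrable mD _ _ (integrable_scale M mD (integrable_norm fi))).
  by apply/measurable_EFinP; exact: measurable_funM.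
move=> x Dx; rewrite /= !lee_fin !normrM normr_id mulrC ler_wpM2r//.
by rewrite (le_trans (hM x Dx))// ler_norm.
Qed.

Lemma Rintegral_ae_ge0 D f : measurable D ->
  mu.-integrable D (EFin \o f) -> {ae mu, forall x, D x -> 0 <= f x} ->
  0 <= \int[mu]_(x in D) f x.
Proof.
move=> mD fi f0; have mf := measurable_int mu fi.
rewrite /Rintegral (@ae_eq_integral _ _ _ mu D (fun x => `|f x|%:E)) //.
- by apply: Rintegral_ge0.
- exact: measurable_int (integrable_norm fi).
- by apply: filterS f0 => x fx Dx /=; rewrite ger0_norm// fx.
Qed.

End RealIntegrable.

Lemma Rintegral_oo_split (R : realType) (a s b : R) (f : R -> R) : a <= s -> s <= b ->
  (@lebesgue_measure R).-integrable `]a, b[ (EFin \o f) ->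
  \int[(@lebesgue_measure R)]_(x in `]a, b[) f x =
  \int[(@lebesgue_measure R)]_(x in `]a, s[) f x +
  \int[(@lebesgue_measure R)]_(x in `]s, b[) f x.
Proof.
rewrite le_eqVlt => /predU1P[<- _ _|as_].
  by rewrite set_itvoo0 Rintegral_set0 add0r.
rewrite le_eqVlt => /predU1P[-> _|sb fi].
  by rewrite set_itvoo0 Rintegral_set0 addr0.
rewrite -(Rintegral_itvB fi (x := s)) ?bnd_simp ?(ltW as_)//.
rewrite (Rintegral_itv_bndo_bndc (r := s)); first by rewrite addrC subrK.
apply: integrableS fi => //; apply: subset_itvl; rewrite bnd_simp; exact: ltW.
Qed.

(** * Approximate identities and cut-offs *)

Section WeakDerivative.
Context {R : realType}.
Implicit Types v dv : R -> R.
Local Notation mu := (@lebesgue_measure R).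

Lemma within_continuousM (A : set R) v w : {within A, continuous v} ->
  {within A, continuous w} -> {within A, continuous (v \* w)}.
Proof. by move=> cv cw x; apply: cvgM; [exact: cv|exact: cw]. Qed.

Lemma continuous_integrable_oo v (a b : R) : {within `[a, b], continuous v} ->
  mu.-integrable `]a, b[ (EFin \o v).
Proof.
move=> cv.
have : mu.-integrable `[a, b] (EFin \o v).
  by apply: continuous_compact_integrable => //; exact: segment_compact.
by apply: integrableS => //; exact: subset_itv_oo_cc.
Qed.

Lemma derivable_continuous v : (forall x : R, derivable v x 1) -> continuous v.
Proof.
by move=> Dv x; apply/differentiable_continuous/derivable1_diffP/Dv.
Qed.

Lemma Rintegral_derive1_oo (psi : R -> R) (a b : R) : a < b ->
  (forall x : R, derivable psi x 1) -> continuous (derive1 psi) ->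
  \int[mu]_(x in `]a, b[) derive1 psi x = psi b - psi a.
Proof.
move=> ab Dpsi cpsi.
have cab : {within `[a, b], continuous (derive1 psi)} by exact: continuous_subspaceT.
rewrite Rintegral_itv_obnd_cbnd; last exact: continuous_integrable_oo.
rewrite Rintegral_itv_bndo_bndc; last first.
  have : mu.-integrable `[a, b] (EFin \o derive1 psi).
    by apply: continuous_compact_integrable => //; exact: segment_compact.
  by apply: integrableS => //; apply: subset_itvl; rewrite bnd_simp.
rewrite /Rintegral (@continuous_FTC2 _ _ psi)//.
have cp := derivable_continuous Dpsi.
split; first by move=> x _; exact: Dpsi.
- exact/cvg_at_right_filter/cp.
- exact/cvg_at_left_filter/cp.
Qed.

(** A smooth step from [0] to [1] across the interval [[s, s + 1/(n+1)]]. *)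
Definition step_at (s : R) (n : nat) (x : R) : R :=
  smooth_step (n.+1%:R * x + - (n.+1%:R * s)).

Lemma step_at_eq0 s n x : x <= s -> step_at s n x = 0.
Proof. by move=> xs; rewrite /step_at smooth_step_eq0// subr_le0 ler_pM2l. Qed.

Lemma step_at_eq1 s n x : s + n.+1%:R^-1 <= x -> step_at s n x = 1.
Proof.
move=> xs; rewrite /step_at smooth_step_eq1// -mulrBr -ler_pdivrMl ?mulr1//.
by rewrite lerBrDl.
Qed.

Lemma differentiable_times_step_at m s n : differentiable_times m (step_at s n).
Proof. exact/differentiable_times_affine/differentiable_times_smooth_step. Qed.

Lemma derivable_step_at s n (x : R) : derivable (step_at s n) x 1.
Proof. by have [] := differentiable_times_step_at 1 s n. Qed.

Lemma continuous_derive_step_at s n : continuous (derive1 (step_at s n)).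
Proof.
apply: derivable_continuous.
by have [_ []] := differentiable_times_step_at 2 s n.
Qed.

Lemma derive_step_at s n x : derive1 (step_at s n) x =
  derive1 smooth_step (n.+1%:R * x + - (n.+1%:R * s)) * n.+1%:R.
Proof.
have ? : is_derive x (1 : R) (fun x => n.+1%:R * x + - (n.+1%:R * s)) (n.+1%:R).
  have := is_deriveD (is_deriveZ (n.+1%:R : R) (is_derive_id x (1 : R)))
    (is_derive_cst (- (n.+1%:R * s)) x (1 : R)).
  by rewrite addr0 /GRing.scale/= mulr1.
have ? := is_derive_derive1 (@derivable_smooth_step R (n.+1%:R * x + - (n.+1%:R * s))).
rewrite derive1E.
have [_ <-//] := @is_derive1_comp _ smooth_step
  (fun x => n.+1%:R * x + - (n.+1%:R * s)) x _ _ _ _.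
Qed.

Lemma derive_step_at_ge0 s n x : 0 <= derive1 (step_at s n) x.
Proof. by rewrite derive_step_at mulr_ge0// smooth_step_derive_ge0. Qed.

Lemma derive_step_at_eq0 s n x : x < s \/ s + n.+1%:R^-1 < x ->
  derive1 (step_at s n) x = 0.
Proof.
move=> xs; rewrite derive_step_at smooth_step_derive_eq0 ?mul0r//.
case: xs => xs; [left|right].
  by rewrite subr_lt0 ltr_pM2l.
by rewrite -mulrBr -ltr_pdivrMl ?mulr1// ltrBrDl.
Qed.

Lemma step_at_cvg s x :
  step_at s n x @[n --> \oo] --> ((s < x)%R%:R : R).
Proof.
have [xs|sx] := leP x s.
  rewrite (_ : (fun n => _) = cst 0); first exact: cvg_cst.
  by apply/funext => n; rewrite step_at_eq0.
apply: cvg_near_cst; near=> n; rewrite step_at_eq1//.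
rewrite -lerBrDl ltW//; near: n.
have xs0 : 0 < x - s by rewrite subr_gt0.
exact: (near_infty_natSinv_lt (PosNum xs0)).
Unshelve. all: by end_near.
Qed.

Lemma step_at_test (a b s t : R) n : a < s -> s <= t -> t + n.+1%:R^-1 < b ->
  test_function `]a, b[ (fun x => step_at s n x - step_at t n x).
Proof.
move=> as_ st tb.
have sub : closure [set x | step_at s n x - step_at t n x != 0] `<=`
    `[s, t + n.+1%:R^-1].
  rewrite (closure_id `[s, t + n.+1%:R^-1]).1; last exact: itv_closed.
  apply: closure_subset => x /= nz; rewrite in_itv /=.
  have [xs|xs] := ltP x s.
    by move: nz; rewrite !step_at_eq0 ?subrr ?eqxx// ltW// (lt_le_trans xs).
  have [//|xt] := leP x (t + n.+1%:R^-1).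
  by move: nz; rewrite !step_at_eq1 ?subrr ?eqxx ?(ltW xt)// ltW//
    (le_lt_trans _ xt)// lerD2r.
split.
- apply: differentiable_timesP => m.
  rewrite (_ : (fun x => _) = step_at s n \+ cst (-1) \* step_at t n).
    apply: differentiable_timesD; first exact: differentiable_times_step_at.
    apply: differentiable_timesM; first exact: differentiable_times_cst.
    exact: differentiable_times_step_at.
  by apply/funext => x; rewrite /= mulN1r.
- apply: (subclosed_compact _ (@segment_compact _ s (t + n.+1%:R^-1))) sub => //.
  exact: closed_closure.
- apply: subset_trans sub _ => x /=; rewrite !in_itv /= => /andP[sx xt].
  by rewrite (lt_le_trans as_ sx) (le_lt_trans xt tb).
Qed.

(** The derivative of [step_at s n] is nonnegative, has integral [1] and vanishes
outside [[s, s + 1/(n+1)]], where [v] is close to [v s]. *)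
Lemma approximate_identity v (a b s : R) : {within `[a, b], continuous v} ->
  a < s < b ->
  \int[mu]_(x in `]a, b[) (v x * derive1 (step_at s n) x) @[n --> \oo] --> v s.
Proof.
move=> cv /andP[as_ sb]; have ab := lt_trans as_ sb.
have cs : {for s, continuous v}.
  have [+ _ _] := (continuous_within_itvP v ab).1 cv.
  by apply; rewrite in_itv /= as_.
apply/cvgrPdist_le => e e0.
have /cvgrPdist_le/(_ e e0)[d /= d0 vd] := cs.
have bs0 : 0 < b - s by rewrite subr_gt0.
near=> n.
have nd : n.+1%:R^-1 < d by near: n; exact: (near_infty_natSinv_lt (PosNum d0)).
have nb : n.+1%:R^-1 < b - s by near: n; exact: (near_infty_natSinv_lt (PosNum bs0)).
have cD : {within `[a, b], continuous (derive1 (step_at s n))}.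
  exact/continuous_subspaceT/continuous_derive_step_at.
have iD := continuous_integrable_oo cD.
have iv := continuous_integrable_oo (within_continuousM cv cD).
have intD : \int[mu]_(x in `]a, b[) derive1 (step_at s n) x = 1.
  rewrite (Rintegral_derive1_oo ab (@derivable_step_at s n)
    (@continuous_derive_step_at s n)).
  by rewrite step_at_eq1 ?step_at_eq0 ?subr0// ?ltW// -ltrBrDl.
rewrite -[v s]mulr1 -intD -RintegralZl// -RintegralB//; last first.
  exact: integrable_scale.
apply: (@le_trans _ _ (\int[mu]_(x in `]a, b[) (e * derive1 (step_at s n) x))).
  apply: le_trans (le_normr_Rintegral _ _) _ => //.
    by apply: integrable_sub => //; exact: integrable_scale.
  apply: le_Rintegral => //.
  - apply: integrable_norm; apply: integrable_sub => //; exact: integrable_scale.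
  - exact: integrable_scale.
  - move=> x _; rewrite -mulrBl normrM (ger0_norm (derive_step_at_ge0 _ _ _)).
    have [xs|xs] := ltP x s.
      by rewrite derive_step_at_eq0 ?mulr0//; left.
    have [xt|xt] := ltP (s + n.+1%:R^-1) x.
      by rewrite derive_step_at_eq0 ?mulr0//; right.
    apply: ler_wpM2r; first exact: derive_step_at_ge0.
    apply: vd; rewrite /ball_/= ler0_norm ?subr_le0// opprB ltrBlDl.
    by rewrite (le_lt_trans xt)// ltrD2l.
by rewrite RintegralZl// intD mulr1.
Unshelve. all: by end_near.
Qed.

(** Dominated convergence: [step_at s n] tends pointwise to the indicator of
[]s, +oo[], with values in [[0, 1]]. *)
Lemma cut_off_limit dv (a b s : R) : mu.-integrable `]a, b[ (EFin \o dv) ->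
  a <= s ->
  \int[mu]_(x in `]a, b[) (dv x * step_at s n x) @[n --> \oo] -->
  \int[mu]_(x in `]s, b[) dv x.
Proof.
move=> iv as_.
have mS n : measurable_fun `]a, b[ (step_at s n).
  have cS : continuous (step_at s n) := derivable_continuous (@derivable_step_at s n).
  by apply: measurable_funTS; exact: continuous_measurable_fun.
have mv : measurable_fun `]a, b[ dv by apply/measurable_EFinP; exact: measurable_int iv.
have -> : \int[mu]_(x in `]s, b[) dv x =
    \int[mu]_(x in `]a, b[) (dv \_ `]s, +oo[) x.
  rewrite -Rintegral_mkcondr; congr (Rintegral _ _ _).
  apply/seteqP; split=> x /=; rewrite !in_itv /= ?andbT.
    by move=> /andP[sx xb]; rewrite (le_lt_trans as_ sx) xb.
  by move=> [/andP[_ ->] ->].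
apply: fine_cvg; rewrite fineK; last first.
  have : mu.-integrable `]a, b[ (EFin \o (dv \_ `]s, +oo[)).
    rewrite -restrict_EFin; apply/integrable_restrict => //.
    by apply: integrableS iv => //; exact: measurableI.
  exact: integrable_fin_num.
apply: (@dominated_cvg _ _ _ mu `]a, b[ _
  (fun n x => (dv x * step_at s n x)%:E) (fun x => ((dv \_ `]s, +oo[) x)%:E)
  (fun x => `|dv x|%:E)) => //.
- by move=> n; apply/measurable_EFinP; exact: (measurable_funM mv (mS n)).
- move=> x _; apply: cvg_EFin; first exact: nearW.
  rewrite (_ : fine \o _ = fun n => dv x * step_at s n x)//.
  rewrite (_ : (dv \_ `]s, +oo[) x = dv x * (s < x)%R%:R).
    by apply: cvgM; [exact: cvg_cst|exact: step_at_cvg].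
  rewrite patchE; case: ifPn; rewrite mem_setE in_itv /= andbT => sx.
    by rewrite sx mulr1.
  by rewrite (negbTE sx) mulr0.
- exact: integrable_norm.
- move=> n x _; rewrite /= lee_fin normrM ler_piMr//.
  by rewrite ger0_norm ?smooth_step_ge0 ?smooth_step_le1.
Qed.
End WeakDerivative.

(** * Weak derivatives of continuous functions *)

Section FTC_weak.
Context {R : realType}.
Implicit Types v dv : R -> R.
Local Notation mu := (@lebesgue_measure R).

(** Extending [dv] by [0] outside []a, b[] reduces this to integrals over closed
intervals of a function that is integrable up to the endpoints. *)
Lemma primitive_continuous dv (a b : R) : a <= b ->
  mu.-integrable `]a, b[ (EFin \o dv) ->
  {within `[a, b], continuous (fun x => \int[mu]_(t in `]a, x[) dv t)}.
Proof.
move=> ab iv; pose w := dv \_ `]a, b[.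
have iw : mu.-integrable setT (EFin \o w).
  by rewrite -restrict_EFin; apply/integrable_restrict => //; rewrite setTI.
have iwD (D : interval R) : mu.-integrable [set` D] (EFin \o w).
  exact: integrableS iw.
have := parameterized_integral_continuous ab (iwD `[a, b]).
apply: subspace_eq_continuous => x; rewrite inE /= in_itv /= => /andP[ax xb].
rewrite /from_subspace /parameterized_integral -Rintegral_itv_obnd_cbnd; last exact: iwD.
rewrite -Rintegral_itv_bndo_bndc; last exact: iwD.
rewrite /w -Rintegral_mkcondr; congr (Rintegral _ _ _).
apply/seteqP; split=> t /=; rewrite !in_itv /=.
  by case.
by move=> /andP[at_ tx]; rewrite at_ tx (lt_le_trans tx xb).
Qed.

Lemma eq_endpoints (f : R -> R) (a b : R) : a < b ->
  {within `[a, b], continuous f} ->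
  (forall s t, a < s -> s <= t -> t < b -> f s = f t) ->
  forall x, a <= x <= b -> f x = f a.
Proof.
move=> ab cf cst_f; have [_ fa fb] := (continuous_within_itvP f ab).1 cf.
have mid x : a < x -> x < b -> f a = f x.
  move=> ax xb.
  suff fx : f @ a^'+ --> f x by exact: (cvg_unique _ fa fx).
  apply: cvg_near_cst.
  near=> y; apply: cst_f => //; near: y; exact: nbhs_right_le.
have midb x : a < x -> x < b -> f b = f x.
  move=> ax xb.
  suff fx : f @ b^'- --> f x by exact: (cvg_unique _ fb fx).
  apply: cvg_near_cst.
  near=> y; apply/esym/cst_f => //; near: y; exact: nbhs_left_ge.
move=> x /andP[]; rewrite le_eqVlt => /predU1P[<-//|ax].
rewrite le_eqVlt => /predU1P[->|xb]; last by rewrite (mid _ ax xb).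
have [am mb] := midf_lt ab.
by rewrite (mid _ am mb) (midb _ am mb).
Unshelve. all: by end_near.
Qed.

(** Testing with [step_at s n - step_at t n] and letting [n] tend to infinity
gives the identity between two interior points; it extends to the endpoints
because both sides are continuous on the closed interval. *)
Lemma weak_derivative_FTC v dv (a b : R) : a < b ->
  {within `[a, b], continuous v} -> mu.-integrable `]a, b[ (EFin \o dv) ->
  (forall phi, test_function `]a, b[ phi ->
    \int[mu]_(t in `]a, b[) (v t * derive1 phi t) =
    - \int[mu]_(t in `]a, b[) (dv t * phi t)) ->
  forall x, a <= x <= b -> v x = v a + \int[mu]_(t in `]a, x[) dv t.
Proof.
move=> ab cv iv weak.
have inner s t : a < s -> s <= t -> t < b ->
    v s - v t = - (\int[mu]_(x in `]s, b[) dv x - \int[mu]_(x in `]t, b[) dv x).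
  move=> as_ st tb.
  have at_ := lt_le_trans as_ st; have sb := le_lt_trans st tb.
  have bt0 : 0 < b - t by rewrite subr_gt0.
  have Is := approximate_identity cv (introT andP (conj as_ sb)).
  have It := approximate_identity cv (introT andP (conj at_ tb)).
  have Js := cut_off_limit iv (ltW as_).
  have Jt := cut_off_limit iv (ltW at_).
  suff L : \int[mu]_(x in `]a, b[) (v x * derive1 (step_at s n) x) -
      \int[mu]_(x in `]a, b[) (v x * derive1 (step_at t n) x) @[n --> \oo] -->
      - (\int[mu]_(x in `]s, b[) dv x - \int[mu]_(x in `]t, b[) dv x).
    by exact: (cvg_unique _ (cvgB Is It) L).
  (* for [n] large the test function has its support in []a, b[], and the two
     sequences coincide *)
  apply: cvg_trans (cvgN (cvgB Js Jt)).
  apply: near_eq_cvg; near=> n.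
  have nb : n.+1%:R^-1 < b - t by near: n; exact: (near_infty_natSinv_lt (PosNum bt0)).
  have tnb : t + n.+1%:R^-1 < b by rewrite -ltrBrDl.
  have cD r : {within `[a, b], continuous (derive1 (step_at r n))}.
    exact/continuous_subspaceT/continuous_derive_step_at.
  have iS r : mu.-integrable `]a, b[ (EFin \o (fun x => dv x * step_at r n x)).
    apply: (@integrable_mulr _ _ _ _ _ _ _ 1) => //.
      have cS : continuous (step_at r n) := derivable_continuous (@derivable_step_at R r n).
      by apply: measurable_funTS; exact: continuous_measurable_fun.
    by move=> x _; rewrite ger0_norm ?smooth_step_ge0 ?smooth_step_le1.
  have iD r : mu.-integrable `]a, b[
      (EFin \o (fun x => v x * derive1 (step_at r n) x)).
    exact: (continuous_integrable_oo (within_continuousM cv (cD r))).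
  have W := weak _ (step_at_test as_ st tnb).
  rewrite -RintegralB//; apply/esym.
  transitivity (\int[mu]_(x in `]a, b[)
      (v x * derive1 (fun y => step_at s n y - step_at t n y) x)).
    apply: eq_Rintegral => x _; rewrite -mulrBr [in RHS]derive1E deriveB.
    + by rewrite -!derive1E.
    + exact: derivable_step_at.
    + exact: derivable_step_at.
  rewrite W; congr (- _); rewrite fctE /= -RintegralB//.
  by apply: eq_Rintegral => x _; rewrite mulrBr.
have cH : {within `[a, b], continuous (fun x => v x - \int[mu]_(t in `]a, x[) dv t)}.
  by move=> x; apply: cvgB; [exact: cv|exact: primitive_continuous (ltW ab) iv x].
move=> x xab.
have cst_H s t : a < s -> s <= t -> t < b ->
    v s - \int[mu]_(r in `]a, s[) dv r = v t - \int[mu]_(r in `]a, t[) dv r.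
  move=> as_ st tb; have sb := le_lt_trans st tb; have at_ := lt_le_trans as_ st.
  have := inner s t as_ st tb.
  have := Rintegral_oo_split (ltW as_) (ltW sb) iv.
  rewrite (Rintegral_oo_split (ltW at_) (ltW tb) iv).
  lra.
have := eq_endpoints ab cH cst_H xab.
by rewrite set_itvoo0 Rintegral_set0 subr0 => <-; rewrite subrK.
Unshelve. all: by end_near.
Qed.
End FTC_weak.

(** * The chain rule for the squared positive part *)

Section ChainRule.
Context {R : realType}.
Implicit Types v dv h : R -> R.
Local Notation mu := (@lebesgue_measure R).

Lemma integrable_mul_continuous dv h (a b : R) : a <= b ->
  mu.-integrable `]a, b[ (EFin \o dv) -> {within `[a, b], continuous h} ->
  mu.-integrable `]a, b[ (EFin \o (fun x => dv x * h x)).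
Proof.
move=> ab iv ch.
have cn : {within `[a, b], continuous (fun x => `|h x|)}.
  by move=> x; apply: cvg_norm; exact: ch.
have [c _ hc] := EVT_max ab cn.
apply: (@integrable_mulr _ _ _ _ _ _ _ (`|h c|)) => //.
  have mh : measurable_fun `[a, b] h by exact: subspace_continuous_measurable_fun.
  apply: measurable_funS mh => //; exact: subset_itv_oo_cc.
by move=> x xab; apply: hc; apply: subset_itv_oo_cc.
Qed.

(** Heine's theorem, by covering compactness: near each point a radius works
for all neighbouring points. *)
Lemma uniformly_continuous_segment v (a b e : R) : 0 < e ->
  {within `[a, b], continuous v} ->
  exists2 d, 0 < d & forall x y, a <= x <= b -> a <= y <= b ->
    `|x - y| < d -> `|v x - v y| <= e.
Proof.
move=> e0 /subspace_continuousP cv.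
have e20 : 0 < e / 2 by exact: divr_gt0.
have /compact_near_coveringP/(_ R (0 : R)^'+
  (fun d x => a <= x <= b -> forall y, a <= y <= b -> `|x - y| < d -> `|v x - v y| <= e))
  := @segment_compact R a b.
case.
  move=> x xab; have /cvgrPdist_le/(_ _ e20) := cv x xab.
  move=> [r /= r0 vr].
  have r20 : 0 < r / 2 by exact: divr_gt0.
  exists (ball x (r / 2), [set d | d < r / 2]) => /=.
    split; first exact: nbhsx_ballx.
    exact: nbhs_right_lt.
  move=> [y d] /= [xy dr] yab z zab yz.
  have zr : `|x - z| < r.
    rewrite (splitr r) (le_lt_trans (ler_distD y _ _))// ltrD//.
    by rewrite (lt_trans yz).
  have yr : `|x - y| < r by rewrite (lt_trans xy)// ltr_pdivrMr// ltr_pMr// ltr1n.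
  rewrite (splitr e) (le_trans (ler_distD (v x) _ _))// lerD//.
    by rewrite distrC; apply: vr => //=; rewrite in_itv.
  by apply: vr => //=; rewrite in_itv.
move=> r /= r0 Hr; exists (r / 2); first exact: divr_gt0.
have r20 : 0 < r / 2 by exact: divr_gt0.
move=> x y xab yab xy.
apply: (Hr (r / 2)) => //=.
  by rewrite sub0r normrN gtr0_norm// ltr_pdivrMr// ltr_pMr// ltr1n.
Qed.

Lemma positive_part_dist (x y : R) :
  `|Num.max x 0 - Num.max y 0| <= `|x - y|.
Proof.
have := ler_norm (x - y); have := ler_norm (y - x); rewrite (distrC y).
rewrite ler_norml; case: (leP x 0) => x0; case: (leP y 0) => y0; lra.
Qed.

(** The tangent inequality at [y] for the convex function [s |-> s_+^2 / 2]. *)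
Lemma positive_part_convex (x y : R) :
  Num.max y 0 ^+ 2 / 2 - Num.max x 0 ^+ 2 / 2 <= Num.max y 0 * (y - x).
Proof.
have := sqr_ge0 x; have := sqr_ge0 y; have := sqr_ge0 (y - x).
case: (leP x 0) => x0; case: (leP y 0) => y0; rewrite ?expr0n/=; try lra.
by have := mulr_le0_ge0 x0 (ltW y0); lra.
Qed.

Lemma positive_part_continuous (A : set R) v : {within A, continuous v} ->
  {within A, continuous (fun x => Num.max (v x) 0)}.
Proof.
by move=> cv x; apply: continuous_max; [exact: cv|exact: cvg_cst].
Qed.

(** The tangent inequality has [v_+ y] where the integral has [v_+ t]; the
difference is at most the oscillation [e], which gives the error term. *)
Lemma positive_part_energy_step v dv (x y e : R) : x <= y ->
  mu.-integrable `]x, y[ (EFin \o dv) -> {within `[x, y], continuous v} ->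
  v y - v x = \int[mu]_(t in `]x, y[) dv t ->
  (forall z, x <= z <= y -> `|v y - v z| <= e) ->
  Num.max (v y) 0 ^+ 2 / 2 - Num.max (v x) 0 ^+ 2 / 2 <=
  \int[mu]_(t in `]x, y[) (dv t * Num.max (v t) 0) +
  e * \int[mu]_(t in `]x, y[) `|dv t|.
Proof.
move=> xy iv cv vxy ve.
have ip := integrable_mul_continuous xy iv (positive_part_continuous cv).
have in_ := integrable_norm iv.
apply: le_trans (positive_part_convex _ _) _.
rewrite vxy -RintegralZl// -RintegralZl// -RintegralD//; last exact: integrable_scale.
apply: le_Rintegral => //.
- exact: integrable_scale.
- by apply: integrable_add => //; exact: integrable_scale.
- move=> z; rewrite /= in_itv /= => /andP[xz zy].
  rewrite addrC -lerBlDr mulrC -mulrBr (le_trans (ler_norm _))//.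
  rewrite normrM mulrC ler_wpM2r// (le_trans (positive_part_dist _ _))//.
  by rewrite ve// ltW//= ltW.
Qed.

(** The error terms of positive_part_energy_step add up to
[e * int |dv|] over any mesh so fine that [v] oscillates by at most [e] on each
cell, and [e] is arbitrary. *)
Lemma positive_part_energy v dv (a b : R) : a < b ->
  {within `[a, b], continuous v} -> mu.-integrable `]a, b[ (EFin \o dv) ->
  (forall x, a <= x <= b -> v x = v a + \int[mu]_(t in `]a, x[) dv t) ->
  forall x, a <= x <= b ->
    Num.max (v x) 0 ^+ 2 / 2 - Num.max (v a) 0 ^+ 2 / 2 <=
    \int[mu]_(t in `]a, x[) (dv t * Num.max (v t) 0).
Proof.
move=> ab cv iv vE x /andP[ax xb].
pose p t := Num.max (v t) 0.
have isub (s t : R) : a <= s -> t <= b -> mu.-integrable `]s, t[ (EFin \o dv).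
  move=> as_ tb; apply: integrableS iv => //.
  by apply: subset_itvW; rewrite ?as_.
have csub (s t : R) : a <= s -> t <= b -> {within `[s, t], continuous v}.
  by move=> as_ tb; apply: continuous_subspaceW cv; exact: subset_itvScc.
have ipx : mu.-integrable `]a, x[ (EFin \o (fun t => dv t * p t)).
  apply: integrable_mul_continuous => //; first exact: isub.
  exact/positive_part_continuous/csub.
have inx := integrable_norm (isub _ _ (lexx a) xb).
pose N := \int[mu]_(t in `]a, x[) `|dv t|.
have N0 : 0 <= N by exact: Rintegral_ge0.
suff H e : 0 < e -> p x ^+ 2 / 2 - p a ^+ 2 / 2 <=
    \int[mu]_(t in `]a, x[) (dv t * p t) + e * N.
  apply/ler_addgt0Pr => e e0.
  have N1 : 0 < N + 1 by rewrite ltr_wpDl.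
  (* the added [1] covers the case [N = 0] *)
  apply: le_trans (H (e / (N + 1)) (divr_gt0 e0 N1)) _.
  by rewrite lerD2l -mulrA ler_piMr ?(ltW e0)// mulrC ler_pdivrMr// mul1r lerDl.
move=> e0; have [d d0 vd] := uniformly_continuous_segment e0 cv.
have [n nd] : exists n : nat, (x - a) / n.+1%:R < d.
  exists (Num.truncn ((x - a) / d)).
  rewrite ltr_pdivrMr ?ltr0n// mulrC -ltr_pdivrMr//.
  have xad : 0 <= (x - a) / d by rewrite divr_ge0 ?subr_ge0 ?(ltW d0).
  by have /andP[] := truncn_itv xad.
pose h := (x - a) / n.+1%:R.
have h0 : 0 <= h by rewrite divr_ge0 ?subr_ge0.
have step k : (k <= n.+1)%N -> p (a + k%:R * h) ^+ 2 / 2 - p a ^+ 2 / 2 <=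
    \int[mu]_(t in `]a, a + k%:R * h[) (dv t * p t) +
    e * \int[mu]_(t in `]a, a + k%:R * h[) `|dv t|.
  elim: k => [_|k IH kn].
    by rewrite mul0r addr0 set_itvoo0 !Rintegral_set0 mulr0 addr0 subrr.
  have ak : a <= a + k%:R * h by rewrite lerDl mulr_ge0.
  have kk : a + k%:R * h <= a + k.+1%:R * h.
    by rewrite lerD2l ler_wpM2r// ler_nat.
  have kx : a + k.+1%:R * h <= x.
    rewrite -lerBrDl /h mulrCA ler_piMr ?subr_ge0//.
    by rewrite ler_pdivrMr// mul1r ler_nat.
  have := IH (ltnW kn).
  have kb := le_trans kx xb; have ak1 := le_trans ak kk.
  have := @positive_part_energy_step v dv _ _ e kk (isub _ _ ak kb) (csub _ _ ak kb).
  have ipk : mu.-integrable `]a, a + k.+1%:R * h[ (EFin \o (fun t => dv t * p t)).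
    apply: integrableS ipx => //; exact: subset_itvW.
  have ink : mu.-integrable `]a, a + k.+1%:R * h[ (EFin \o (fun t => `|dv t|)).
    apply: integrableS inx => //; exact: subset_itvW.
  rewrite (Rintegral_oo_split ak kk ipk) (Rintegral_oo_split ak kk ink).
  have -> : v (a + k.+1%:R * h) - v (a + k%:R * h) =
      \int[mu]_(t in `]a + k%:R * h, a + k.+1%:R * h[) dv t.
    rewrite vE ?ak1// [v (a + k%:R * h)]vE ?ak ?(le_trans kk)//.
    rewrite (Rintegral_oo_split ak kk (isub _ _ (lexx a) kb)).
    by rewrite opprD addrACA subrr add0r addrAC subrr add0r.
  rewrite -/(p _) -/(p _) => /(_ erefl) S I.
  have /S : forall z, a + k%:R * h <= z <= a + k.+1%:R * h ->
      `|v (a + k.+1%:R * h) - v z| <= e.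
    move=> z /andP[kz zk]; apply: vd.
    - by rewrite ak1 kb.
    - by rewrite (le_trans ak kz) (le_trans zk kb).
    - rewrite ger0_norm ?subr_ge0//; apply: le_lt_trans nd.
      by rewrite -/h; move: kz; rewrite -[k.+1]addn1 natrD mulrDl; lra.
  by move: I; rewrite mulrDr /p; lra.
have nx : a + n.+1%:R * h = x.
  by rewrite [_ * h]mulrC divfK ?pnatr_eq0// addrC subrK.
by have := step n.+1 (leqnn _); rewrite nx.
Qed.
End ChainRule.

(** * Gronwall's lemma *)

Section Gronwall.
Context {R : realType}.
Local Notation mu := (@lebesgue_measure R).

(** Steps of length [1 / (2 K)]: if [E] vanishes up to [k] steps, let [c] be a
maximum point of [E] up to some [x] in the next step.  Only the last step
contributes to the integral up to [c], so [E c <= K (1 / (2 K)) E c]. *)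
Lemma gronwall_zero (E : R -> R) (K T : R) : 0 < K -> 0 < T ->
  {within `[0, T], continuous E} -> (forall x, 0 <= x <= T -> 0 <= E x) ->
  (forall x, 0 <= x <= T -> E x <= K * \int[mu]_(t in `]0, x[) E t) ->
  forall x, 0 <= x <= T -> E x = 0.
Proof.
move=> K0 T0 cE E0 EK; pose d := (2 * K)^-1.
have d0 : 0 < d by rewrite invr_gt0 mulr_gt0.
have vanish (k : nat) x : 0 <= x <= T -> x <= k%:R * d -> E x = 0.
  elim: k x => [|k IH] x /andP[x0 xT] xk.
    have -> : x = 0 by apply/eqP; rewrite eq_le x0 andbT -(mul0r d).
    apply/eqP; rewrite eq_le E0 ?lexx ?(ltW T0)// andbT.
    by apply: le_trans (EK _ _) _; rewrite ?lexx ?(ltW T0)//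
      set_itvoo0 Rintegral_set0 mulr0.
  have cEx : {within `[0, x], continuous E}.
    by apply: continuous_subspaceW cE; exact: subset_itvScc.
  have [c] := EVT_max x0 cEx.
  rewrite in_itv /= => /andP[c0 cx] Ec.
  have cT := le_trans cx xT.
  have Ec0 : 0 <= E c by rewrite E0 ?c0.
  suff Hc : E c <= 0.
    by apply/eqP; rewrite eq_le E0 ?x0// andbT (le_trans _ Hc)// Ec// in_itv /= x0 lexx.
  have [ck|kc] := leP c (k%:R * d); first by rewrite IH ?c0.
  have kd0 : 0 <= k%:R * d by rewrite mulr_ge0// ltW.
  have cEc : {within `[0, c], continuous E}.
    by apply: continuous_subspaceW cEx; exact: subset_itvScc.
  have iE := continuous_integrable_oo cEc.
  have := EK c; rewrite c0 cT => /(_ isT).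
  rewrite (Rintegral_oo_split kd0 (ltW kc) iE).
  have -> : \int[mu]_(t in `]0, k%:R * d[) E t = 0.
    rewrite (@eq_Rintegral _ _ _ _ _ (cst 0)); first by rewrite Rintegral_cst// mul0r.
    move=> t; rewrite inE /= in_itv /= => /andP[t0 tk].
    apply: IH; last exact: ltW.
    by rewrite (ltW t0) (le_trans (ltW tk))// (le_trans (ltW kc)).
  have : \int[mu]_(t in `]k%:R * d, c[) E t <= E c * d.
    apply: (@le_trans _ _ (\int[mu]_(t in `]k%:R * d, c[) (cst (E c) t))).
      apply: le_Rintegral => //.
      - apply: integrableS iE => //; exact: subset_itvr.
      - apply: continuous_integrable_oo; exact: continuous_subspaceT (@cst_continuous _ _ _).
      - move=> t; rewrite /= in_itv /= => /andP[kt tc]; apply: Ec.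
        by rewrite in_itv /= (le_trans kd0 (ltW kt)) (le_trans (ltW tc)).
    rewrite Rintegral_cst//. 
    have muE : mu `]k%:R * d, c[%classic = (c - k%:R * d)%:E.
      by have := lebesgue_measure_itv `]k%:R * d, c[; rewrite /= lte_fin kc EFinB.
    rewrite (_ : fine _ = c - k%:R * d); last exact: (congr1 fine muE).
    by rewrite ler_wpM2l// lerBlDl (le_trans cx)// (le_trans xk)//
      -[k.+1]addn1 natrD mulrDl mul1r.
  rewrite add0r -(ler_pM2l K0) => H1 H2; have := le_trans H2 H1.
  by rewrite mulrCA /d invfM [K * _]mulrCA divff ?gt_eqF// mulr1; lra.
move=> x xT; apply: (vanish (Num.truncn (x / d)).+1) => //.
have xd : 0 <= x / d by rewrite divr_ge0 ?(ltW d0)//; case/andP: xT.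
by rewrite -ler_pdivrMr// ltW//; have /andP[] := truncn_itv xd.
Qed.
End Gronwall.

(** * Inner products on the graph *)

Section Graph.
Context {R : realType} {V : finType}.
Implicit Types (G : wgraph R V) (r : R) (u v w f : V -> R).

Lemma degree_powR_gt0 G r i : 0 < degree G i `^ r.
Proof. by rewrite powR_gt0// /degree degree_gt0. Qed.

Lemma ipVDl G r u v w : ipV G r (u + v) w = ipV G r u w + ipV G r v w.
Proof. by rewrite -big_split; apply: eq_bigr => i _; rewrite /= !mulrDl. Qed.

Lemma ipVNl G r u w : ipV G r (- u) w = - ipV G r u w.
Proof. by rewrite -sumrN; apply: eq_bigr => i _; rewrite /= !mulNr. Qed.

Lemma ipVZl G r k u w : ipV G r (k *: u) w = k * ipV G r u w.
Proof. by rewrite mulr_sumr; apply: eq_bigr => i _; rewrite /= -!mulrA. Qed.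

Lemma ipEBl G a b c : ipE G (a - b) c = ipE G a c - ipE G b c.
Proof.
rewrite -mulrBr -sumrB; congr (_ * _); apply: eq_bigr => i _.
by rewrite -sumrB; apply: eq_bigr => j _; rewrite !mulrBl.
Qed.

Lemma gradD G u v : grad G (u + v) = grad G u + grad G v.
Proof.
apply/funext => i; apply/funext => j; rewrite /grad !fctE.
by case: ifP => _; [rewrite opprD addrACA|rewrite addr0].
Qed.

Lemma gradB G u v : grad G (u - v) = grad G u - grad G v.
Proof. by apply/eqP; rewrite eq_sym subr_eq -gradD subrK. Qed.

Lemma ipV_positive_part G r v : ipV G r v v^\+ = ipV G r v^\+ v^\+.
Proof.
apply: eq_bigr => i _; rewrite /funrpos; congr (_ * _).
by case: (leP (v i) 0); rewrite ?mulr0.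
Qed.

(** The increments of [v] and of [v_+] along an edge never have opposite signs. *)
Lemma ipE_positive_part_ge0 G v : 0 <= ipE G (grad G v) (grad G v^\+).
Proof.
rewrite mulr_ge0 ?invr_ge0//; apply: sumr_ge0 => i _; apply: sumr_ge0 => j _.
rewrite /grad; case: ifPn => [aij|_]; last by rewrite mul0r mul0r.
rewrite mulr_ge0 ?(ltW (weight_gt0 aij))// /funrpos.
case: (leP (v i) 0) => i0; case: (leP (v j) 0) => j0.
- by rewrite subrr mulr0.
- by apply: mulr_ge0; lra.
- by apply: mulr_le0; lra.
- by rewrite -expr2 sqr_ge0.
Qed.

(** The variational inequality tested with [u + (w - u)_+ = max u w]. *)
Lemma comparison_pointwise G r (eps : R) w dw u du : 0 < eps ->
  (forall i, w i <= 1) -> (forall i, 0 <= u i <= 1) ->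
  (forall eta : V -> R, VX `[0, 1] eta ->
    0 <= ipV G r (du - eps^-1 *: u + cst (2 * eps)^-1) (eta - u)
         + ipE G (grad G u) (grad G eta - grad G u)) ->
  ipV G r (dw - du) (w - u)^\+ - eps^-1 * ipV G r (w - u)^\+ (w - u)^\+ <=
  ipV G r (dw + cst (2 * eps)^-1) (w - u)^\+
    + ipE G (grad G w) (grad G (w - u)^\+) - eps^-1 * ipV G r w (w - u)^\+.
Proof.
move=> eps0 w1 u01 ineq.
have etaV : VX `[0, 1] (u + (w - u)^\+).
  move=> i; rewrite /= in_itv /=; change (0 <= u i + Num.max (w i - u i) 0 <= 1).
  by have := w1 i; have /andP[] := u01 i; case: (leP (w i - u i) 0) => ?; lra.
have := ineq _ etaV.
have := ipE_positive_part_ge0 G (w - u); rewrite -ipV_positive_part.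
set z := (w - u)^\+; rewrite gradB gradD ipEBl.
rewrite [u + z]addrC addrK [grad G u + _]addrC addrK !(ipVDl, ipVNl, ipVZl) !mulrBr.
lra.
Qed.
End Graph.

(** * Time-dependent functions on the graph *)

Section Evolution.
Context {R : realType} {V : finType}.
Local Notation mu := (@lebesgue_measure R).

Lemma continuous_sum (A : set R) (I : Type) (s : seq I) (F : I -> R -> R) :
  (forall i, {within A, continuous (F i)}) ->
  {within A, continuous (fun x => \sum_(i <- s) F i x)}.
Proof.
move=> cF; apply: continuous_big => [|i _]; last exact: cF.
exact: add_continuous.
Qed.

(** On a set of finite measure, [|a| <= 1 + a^2] suffices. *)
Lemma L2_integrable (G : wgraph R V) (r T : R) (u : R -> V -> R) :
  L2 G r `]0, T[ u -> forall i, mu.-integrable `]0, T[ (EFin \o u ^~ i).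
Proof.
move=> [mu_ uoo] i; have c0 := degree_powR_gt0 G r i.
pose g t := 1 + (degree G i `^ r)^-1 * ipV G r (u t) (u t).
have mipV : measurable_fun `]0, T[ (fun t => ipV G r (u t) (u t)).
  apply: measurable_sum => j; apply: measurable_funM; last exact: measurable_cst.
  by apply: measurable_funM; exact: mu_.
have ipV0 t : 0 <= ipV G r (u t) (u t).
  by apply: sumr_ge0 => j _; rewrite mulr_ge0 ?powR_ge0// -expr2 sqr_ge0.
have ig : mu.-integrable `]0, T[ (EFin \o g).
  apply: integrable_add => //.
    apply: continuous_integrable_oo; exact: continuous_subspaceT (@cst_continuous _ _ _).
  apply: integrable_scale => //; apply/integrableP; split.
    by apply/measurable_EFinP; exact: mipV.
  apply: le_lt_trans uoo; rewrite le_eqVlt; apply/orP; left; apply/eqP.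
  by apply: eq_integral => t _; rewrite /= ger0_norm.
apply: le_integrable ig => //; first by apply/measurable_EFinP; exact: mu_.
move=> t _; rewrite /= lee_fin.
have h : u t i ^+ 2 <= (degree G i `^ r)^-1 * ipV G r (u t) (u t).
  rewrite ler_pdivlMl// mulrC /ipV (bigD1 i)//= -expr2 lerDl.
  by apply: sumr_ge0 => j _; rewrite mulr_ge0 ?powR_ge0// -expr2 sqr_ge0.
rewrite [leRHS]ger0_norm /g ?addr_ge0 ?(le_trans (sqr_ge0 _) h)//.
rewrite -real_normK ?num_real// in h; set a := `|u t i| in h *.
by have := sqr_ge0 (a - 1); have : 0 <= a := normr_ge0 _; nra.
Qed.

Lemma H1_FTC (G : wgraph R V) (r T : R) (u du : R -> V -> R) : 0 < T ->
  H1 G r `]0, T[ u du -> (forall i, {within `[0, T], continuous (u ^~ i)}) ->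
  forall i x, 0 <= x <= T -> u x i = u 0 i + \int[mu]_(t in `]0, x[) du t i.
Proof.
move=> T0 [_ L2du weak] cu i.
apply: (weak_derivative_FTC T0 (cu i) (L2_integrable L2du i)).
by move=> phi /weak; apply.
Qed.

Lemma continuous_ipV (A : set R) (G : wgraph R V) (r : R) (u v : R -> V -> R) :
  (forall i, {within A, continuous (u ^~ i)}) ->
  (forall i, {within A, continuous (v ^~ i)}) ->
  {within A, continuous (fun t => ipV G r (u t) (v t))}.
Proof.
move=> cu cv; apply: continuous_sum => i.
have cc : {within A, continuous (cst (degree G i `^ r) : R -> R)}.
  exact: continuous_subspaceT (@cst_continuous _ _ _).
exact: within_continuousM (within_continuousM (cu i) (cv i)) cc.
Qed.

Lemma continuous_grad (A : set R) (G : wgraph R V) (u : R -> V -> R) i j :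
  (forall i, {within A, continuous (u ^~ i)}) ->
  {within A, continuous (fun t => grad G (u t) i j)}.
Proof.
move=> cu; rewrite /grad; case: (adj G i j).
  by move=> x; apply: cvgB; exact: cu.
exact: continuous_subspaceT (@cst_continuous _ _ _).
Qed.

Lemma continuous_ipE (A : set R) (G : wgraph R V) (u v : R -> V -> R) :
  (forall i, {within A, continuous (u ^~ i)}) ->
  (forall i, {within A, continuous (v ^~ i)}) ->
  {within A, continuous (fun t => ipE G (grad G (u t)) (grad G (v t)))}.
Proof.
move=> cu cv.
have cc (k : R) : {within A, continuous (cst k : R -> R)}.
  exact: continuous_subspaceT (@cst_continuous _ _ _).
apply: within_continuousM (cc _) _.
apply: continuous_sum => i; apply: continuous_sum => j.
apply: within_continuousM (cc _).
by apply: within_continuousM; exact: continuous_grad.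
Qed.

Lemma integrable_ipV (a b : R) (G : wgraph R V) (r : R) (du v : R -> V -> R) :
  a <= b -> (forall i, mu.-integrable `]a, b[ (EFin \o du ^~ i)) ->
  (forall i, {within `[a, b], continuous (v ^~ i)}) ->
  mu.-integrable `]a, b[ (EFin \o (fun t => ipV G r (du t) (v t))).
Proof.
move=> ab idu cv; apply: integrable_sumR => // i.
rewrite (_ : EFin \o _ = EFin \o (fun x => degree G i `^ r * (du x i * v x i))).
  by apply: integrable_scale => //; exact: integrable_mul_continuous.
by apply/funext => x /=; rewrite mulrC.
Qed.

(** The sum over the vertices of positive_part_energy, weighted by the powers of
the degrees. *)
Lemma positive_part_energy_ipV (T : R) (G : wgraph R V) (r : R)
    (v dv : R -> V -> R) : 0 < T ->
  (forall i, {within `[0, T], continuous (v ^~ i)}) ->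
  (forall i, mu.-integrable `]0, T[ (EFin \o dv ^~ i)) ->
  (forall i x, 0 <= x <= T -> v x i = v 0 i + \int[mu]_(t in `]0, x[) dv t i) ->
  (forall i, v 0 i <= 0) ->
  forall x, 0 <= x <= T ->
  ipV G r (v x)^\+ (v x)^\+ <= 2 * \int[mu]_(t in `]0, x[) ipV G r (dv t) (v t)^\+.
Proof.
move=> T0 cv idv FTC v0 x /andP[x0 xT].
have idvx i : mu.-integrable `]0, x[ (EFin \o dv ^~ i).
  by apply: integrableS (idv i) => //; apply: subset_itvW.
have cp i : {within `[0, x], continuous (fun t => Num.max (v t i) 0)}.
  apply: positive_part_continuous; apply: continuous_subspaceW (cv i).
  exact: subset_itvScc.
have ip i := integrable_mul_continuous x0 (idvx i) (cp i).
rewrite (_ : \int[mu]_(t in _) _ =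
  \sum_i \int[mu]_(t in `]0, x[)
    (degree G i `^ r * (dv t i * Num.max (v t i) 0))); last first.
  rewrite -Rintegral_sum//; last by move=> i; exact: integrable_scale.
  by apply: eq_Rintegral => t _; apply: eq_bigr => i _; rewrite mulrC.
rewrite mulr_sumr; apply: ler_sum => i _; rewrite RintegralZl// mulrCA mulrC.
rewrite ler_pM2l ?degree_powR_gt0//.
have := positive_part_energy T0 (cv i) (idv i) (FTC i).
move=> /(_ x); rewrite x0 xT => /(_ isT).
have -> : Num.max (v 0 i) 0 = 0 by apply/max_idPr.
rewrite /funrpos; lra.
Qed.
End Evolution.

(** * The comparison principle *)

Local Notation mu := lebesgue_measure.

(** These two lemmas evaluate the integrand at a test function that is switched
off after a given time. *)
Lemma ipV_cutoff (R : realType) (V : finType) (G : wgraph R V) r (a b : V -> R)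
  (k : bool) : ipV G r a (if k then b else cst 0) = if k then ipV G r a b else 0.
Proof. by case: k => //; apply: big1 => i _; rewrite mulr0 mul0r. Qed.

Lemma ipE_cutoff (R : realType) (V : finType) (G : wgraph R V) (a b : V -> R)
  (k : bool) : ipE G (grad G a) (grad G (if k then b else cst 0)) =
  if k then ipE G (grad G a) (grad G b) else 0.
Proof.
case: k => //; rewrite /ipE big1 ?mulr0// => i _; apply: big1 => j _.
by rewrite /grad subr0; case: ifP; rewrite mulr0 mul0r.
Qed.

Theorem theoremC1 (R : realType) (V : finType) (G : wgraph R V)
    (r : R) (hr : 0 <= r <= 1) (eps : R) (heps : 0 < eps)
    (T : R) (hT : 0 < T)
    (w dw u du : R -> V -> R)
    (hw : H1 G r `]0, T[ w dw)
    (hw_cont : forall i, {within `[0, T], continuous (w ^~ i)})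
    (hw_val : forall t, 0 <= t <= T -> VX `]-oo, 1] (w t))
    (hu : H1 G r `]0, T[ u du)
    (hu_cont : forall i, {within `[0, T], continuous (u ^~ i)})
    (hu_val : forall t, 0 <= t <= T -> VX `[0, 1] (u t))
    (hu_ineq : {ae @lebesgue_measure R, forall t, 0 < t < T ->
      forall eta : V -> R, VX `[0, 1] eta ->
        0 <= ipV G r (du t - eps^-1 *: u t + cst (2 * eps)^-1) (eta - u t)
             + ipE G (grad G (u t)) (grad G eta - grad G (u t))})
    (h0 : forall i, w 0 i <= u 0 i)
    (hf : exists f : R -> V -> R,
      [/\ (@lebesgue_measure R).-integrable `]0, T[
            (fun t => (ipV G r (f t) (w t - u t)^\+)%:E),
          forall T' : R, 0 <= T' <= T ->
            \int[@lebesgue_measure R]_(t in `]0, T'[)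
               ipV G r (f t) (w t - u t)^\+
            <= \int[@lebesgue_measure R]_(t in `]0, T'[)
               ipV G r (w t) (w t - u t)^\+
        & forall eta : R -> V -> R,
            (forall t, 0 < t < T -> VX `[0, +oo[ (eta t)) ->
            (@lebesgue_measure R).-integrable `]0, T[
              (fun t => (ipV G r (dw t + cst (2 * eps)^-1) (eta t)
                         + ipE G (grad G (w t)) (grad G (eta t))
                         - eps^-1 * ipV G r (f t) (eta t))%:E) ->
            \int[@lebesgue_measure R]_(t in `]0, T[)
              (ipV G r (dw t + cst (2 * eps)^-1) (eta t)
               + ipE G (grad G (w t)) (grad G (eta t))
               - eps^-1 * ipV G r (f t) (eta t)) <= 0]) :
  forall (i : V) (t : R), 0 <= t <= T -> w t i <= u t i.
Proof.
have [_ L2dw _] := hw; have [_ L2du _] := hu.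
have idw := L2_integrable L2dw; have idu := L2_integrable L2du.
case: hf => f [ifz fz_le_wz weak_ineq].
pose z t : V -> R := (w t - u t)^\+.
have T0 := ltW hT.
have cv i : {within `[0, T], continuous (fun t => w t i - u t i)}.
  by move=> t; apply: cvgB; [exact: hw_cont|exact: hu_cont].
have cz i : {within `[0, T], continuous (z ^~ i)}.
  exact: (positive_part_continuous (cv i)).
have idv i : mu.-integrable `]0, T[ (EFin \o (fun t => dw t i - du t i)).
  by apply: integrable_sub.
have FTC i x : 0 <= x <= T ->
    w x i - u x i = w 0 i - u 0 i + \int[mu]_(t in `]0, x[) (dw t i - du t i).
  move=> x0T; have /andP[x0 xT] := x0T.
  have sub : `]0, x[ `<=` `]0, T[ by exact: subset_itvW.
  rewrite RintegralB//; [|exact: integrableS (idw i)|exact: integrableS (idu i)].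
  by rewrite (H1_FTC hT hw hw_cont _ x0T) (H1_FTC hT hu hu_cont _ x0T); lra.
have energy x : 0 <= x <= T -> ipV G r (z x) (z x) <=
    2 * \int[mu]_(t in `]0, x[) ipV G r (dw t - du t) (z t).
  apply: (positive_part_energy_ipV G r hT cv idv FTC) => i.
  by rewrite subr_le0.
pose A t := ipV G r (dw t + cst (2 * eps)^-1) (z t) + ipE G (grad G (w t)) (grad G (z t)).
have iA : mu.-integrable `]0, T[ (EFin \o A).
  apply: integrable_add => //.
    apply: integrable_ipV => // i; apply: integrable_add => //.
    apply: continuous_integrable_oo; exact: continuous_subspaceT (@cst_continuous _ _ _).
  by apply: continuous_integrable_oo; exact: continuous_ipE.
have iwz : mu.-integrable `]0, T[ (EFin \o (fun t => ipV G r (w t) (z t))).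
  by apply: continuous_integrable_oo; exact: continuous_ipV.
have czz : {within `[0, T], continuous (fun t => ipV G r (z t) (z t))}.
  exact: continuous_ipV.
have izz := continuous_integrable_oo czz.
have idvz : mu.-integrable `]0, T[ (EFin \o (fun t => ipV G r (dw t - du t) (z t))).
  exact: integrable_ipV.
(* the inequality for [w], tested with [z] on []0, x[] and with [0] afterwards *)
have Aw_le0 x : 0 <= x <= T ->
    \int[mu]_(t in `]0, x[) (A t - eps^-1 * ipV G r (w t) (z t)) <= 0.
  move=> x0T; have /andP[x0 xT] := x0T.
  have sub : `]0, x[ `<=` `]0, T[ by exact: subset_itvW.
  pose eta t : V -> R := if t < x then z t else cst 0.
  pose Q t := A t - eps^-1 * ipV G r (f t) (z t).
  have iQ : mu.-integrable `]0, T[ (EFin \o Q).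
    by apply: integrable_sub => //; exact: integrable_scale.
  have etaE : (fun t => ipV G r (dw t + cst (2 * eps)^-1) (eta t)
      + ipE G (grad G (w t)) (grad G (eta t)) - eps^-1 * ipV G r (f t) (eta t)) =
      Q \_ `]-oo, x[.
    apply/funext => t; rewrite /eta !ipV_cutoff ipE_cutoff patchE.
    rewrite mem_setE in_itv /=; case: ifP => // _.
    by rewrite addr0 mulr0 subr0.
  have etaV t : 0 < t < T -> VX `[0, +oo[ (eta t).
    move=> _ i; rewrite /= in_itv /= andbT /eta; case: ifP => // _.
    by rewrite /z /funrpos le_max lexx orbT.
  have xE : `]0, x[%classic = `]0, T[ `&` `]-oo, x[ :> set R.
    apply/seteqP; split=> t /=; rewrite !in_itv /=.
      by move=> /andP[t0 tx]; rewrite t0 tx (lt_le_trans tx xT).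
    by move=> [/andP[-> _] ->].
  have ieta : mu.-integrable `]0, T[ (EFin \o (Q \_ `]-oo, x[)).
    rewrite -restrict_EFin; apply/integrable_restrict => //.
    by apply: integrableS iQ => //; exact: measurableI.
  have : \int[mu]_(t in `]0, x[) Q t <= 0.
    rewrite xE Rintegral_mkcondr -etaE; apply: (weak_ineq eta etaV).
    by move: ieta; rewrite -etaE.
  have iAx : mu.-integrable `]0, x[ (EFin \o A) by exact: integrableS iA.
  have ifx : mu.-integrable `]0, x[ (EFin \o (fun t => ipV G r (f t) (z t))).
    exact: integrableS ifz.
  have iwx : mu.-integrable `]0, x[ (EFin \o (fun t => ipV G r (w t) (z t))).
    exact: integrableS iwz.
  rewrite !RintegralB ?RintegralZl//; [|exact: integrable_scale..].
  have := fz_le_wz x x0T; rewrite -(ler_pM2l (_ : 0 < eps^-1)) ?invr_gt0//.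
  lra.
have key x : 0 <= x <= T -> ipV G r (z x) (z x) <=
    2 * eps^-1 * \int[mu]_(t in `]0, x[) ipV G r (z t) (z t).
  move=> x0T; have /andP[x0 xT] := x0T.
  have sub : `]0, x[ `<=` `]0, T[ by exact: subset_itvW.
  have iAw : mu.-integrable `]0, x[ (EFin \o (fun t => A t - eps^-1 * ipV G r (w t) (z t))).
    apply: integrable_sub => //; first exact: integrableS iA.
    by apply: integrable_scale => //; exact: integrableS iwz.
  have izzx : mu.-integrable `]0, x[ (EFin \o (fun t => eps^-1 * ipV G r (z t) (z t))).
    by apply: integrable_scale => //; exact: integrableS izz.
  have idvzx : mu.-integrable `]0, x[ (EFin \o (fun t => ipV G r (dw t - du t) (z t))).
    exact: integrableS idvz.
  have : 0 <= \int[mu]_(t in `]0, x[) ((A t - eps^-1 * ipV G r (w t) (z t)) -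
      (ipV G r (dw t - du t) (z t) - eps^-1 * ipV G r (z t) (z t))).
    apply: Rintegral_ae_ge0 => //.
      by apply: integrable_sub => //; exact: integrable_sub.
    apply: (@filterS _ _ (ae_filter_ringOfSetsType mu) _ _ _ hu_ineq) => t ineq.
    rewrite /= in_itv /= => /andP[t0 tx].
    have tT : 0 < t < T by rewrite t0 (lt_le_trans tx).
    have tT' : 0 <= t <= T by rewrite !ltW//; case/andP: tT.
    rewrite subr_ge0; apply: comparison_pointwise => //; last exact: ineq.
      by move=> i; have := hw_val t tT' i; rewrite /= in_itv.
    by move=> i; have := hu_val t tT' i; rewrite /= in_itv.
  rewrite RintegralB//; last by exact: integrable_sub.
  rewrite [X in _ - X]RintegralB// RintegralZl//; last exact: integrableS izz.
  have := Aw_le0 x x0T; have := energy x x0T; lra.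
have ipV0 t : 0 <= ipV G r (z t) (z t).
  by apply: sumr_ge0 => i _; rewrite mulr_ge0 ?powR_ge0// -expr2 sqr_ge0.
have K0 : 0 < 2 * eps^-1 by rewrite mulr_gt0 ?invr_gt0.
move=> i t tT.
have /eqP := gronwall_zero K0 hT czz (fun x _ => ipV0 x) key tT.
rewrite psumr_eq0; last first.
  by move=> j _; rewrite mulr_ge0 ?powR_ge0// -expr2 sqr_ge0.
move=> /allP/(_ i (mem_index_enum i)) /=.
rewrite mulf_eq0 (gt_eqF (degree_powR_gt0 _ _ _)) orbF -expr2 sqrf_eq0.
by rewrite -subr_le0 => /eqP <-; rewrite /z /funrpos le_max lexx.
Qed.
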